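(* Let $R$ be a ring that is a finite-dimensional algebra over each of two fields $k_1$ and $k_2$, and suppose that $R$ is a Frobenius $k_1$-algebra (equivalently, a Frobenius $k_2$-algebra). Then the contravariant functors $\mathrm{Hom}_{k_1}(-,k_1)$ and $\mathrm{Hom}_{k_2}(-,k_2)$ from the category of left $R$-modules to the category of right $R$-modules are naturally equivalent. That is, the $k$-dual functor of a Frobenius $k$-algebra is independent of $k$.
   Context: Rings are associative with identity. A ring $R$ is an algebra over a field $k$ via a unital ring homomorphism $k \to Z(R)$ into the center of $R$; no relation between $k_1$ and $k_2$ is assumed. For a left $R$-module $X$, the $k$-dual $\mathrm{Hom}_k(X,k)$ is a right $R$-module via $(fr)(x) = f(rx)$. For a finite-dimensional $k$-algebra $R$, $\hat R = \mathrm{Hom}_k(R,k)$ is an $(R,R)$-bimodule via $(rf)(s) = f(sr)$ and $(fr)(s) = f(rs)$, and $R$ is a Frobenius $k$-algebra if $R \simeq \hat R$ as left $R$-modules; equivalently, there is a $k$-linear functional $R \to k$ whose kernel contains no nonzero left ideal. It is known that this is equivalent to $R$ being isomorphic as a left $R$-module to the injective hull of $R/\mathrm{rad}\,R$ (with $\mathrm{rad}\,R$ the Jacobson radical), so being a Frobenius $k$-algebra does not depend on $k$. *)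

(* Defs.v *)
From HB Require Import structures.
From mathcomp Require Import all_boot all_algebra.
From mathcomp Require Import boolp.

Set Implicit Arguments.
Unset Strict Implicit.
Unset Printing Implicit Defensive.

Import GRing.Theory.
Local Open Scope ring_scope.

(* Rings are [pzRingType]s, so that the zero ring is not
   excluded.  Left R-modules are [lmodType R]; right R-modules are
   [lmodType R^c], where r *: x stands for the right action x r. *)

(* One ring R may carry several such structures at once, which the canonical
   instances of [algType k] would not allow. *)
Record algebra_over (k : fieldType) (R : pzRingType) := AlgebraOver {
  structure_map :> {rmorphism k -> R};
  structure_map_central : forall (a : k) (r : R), structure_map a * r = r * structure_map a
}.

Definition restr_scalars (k : fieldType) (R : pzRingType)
  (A : algebra_over k R) (X : lmodType R) : Type := X.

Section RestrictionOfScalars.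
Variables (k : fieldType) (R : pzRingType) (A : algebra_over k R).
Variable X : lmodType R.

HB.instance Definition _ := GRing.Zmodule.on (restr_scalars A X).

Definition restr_scale (a : k) (x : restr_scalars A X) : restr_scalars A X :=
  A a *: (x : X).

Fact restr_scaleA a b x : restr_scale a (restr_scale b x) = restr_scale (a * b) x.
Proof. by rewrite /restr_scale rmorphM scalerA. Qed.

Fact restr_scale1 : left_id 1 restr_scale.
Proof. by move=> x; rewrite /restr_scale rmorph1 scale1r. Qed.

Fact restr_scaleDr : right_distributive restr_scale +%R.
Proof. by move=> a x y; exact: (@scalerDr _ X). Qed.

Fact restr_scaleDl x : {morph restr_scale^~ x : a b / a + b}.
Proof. by move=> a b; rewrite /restr_scale rmorphD; exact: (@scalerDl _ X). Qed.

HB.instance Definition _ := GRing.Zmodule_isLmodule.Build k (restr_scalars A X)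
  restr_scaleA restr_scale1 restr_scaleDr restr_scaleDl.

End RestrictionOfScalars.

Definition finite_dim (k : fieldType) (R : pzRingType) (A : algebra_over k R) : Prop :=
  exists n : nat, inhabited (Vector.axiom n (restr_scalars A R^o)).

(* Hom_k(X, k) *)
Definition kdual (k : fieldType) (R : pzRingType)
  (A : algebra_over k R) (X : lmodType R) : Type :=
  {linear restr_scalars A X -> k^o}.

Section Dual.
Variables (k : fieldType) (R : pzRingType) (A : algebra_over k R).
Variable X : lmodType R.
Local Notation D := (kdual A X).
Local Notation hom := {linear restr_scalars A X -> k^o}.

HB.instance Definition _ := gen_eqMixin D.
HB.instance Definition _ := gen_choiceMixin D.

Definition kdual_eval (f : D) (x : X) : k := (f : hom) x.

Lemma kdual_ext (f g : D) : kdual_eval f =1 kdual_eval g -> f = g.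
Proof.
case: f => f [[p] [q]]; case: g => g [[p'] [q']] E.
have {E} E : f = g by apply/funext => x; exact: E.
case: _ / E p' q' => p' q'.
by rewrite (Prop_irrelevance p p') (Prop_irrelevance q q').
Qed.

Definition kdual_zero : D := (\0 : restr_scalars A X -> k^o).
Definition kdual_add (f g : D) : D := ((f : hom) \+ (g : hom)).
Definition kdual_opp (f : D) : D := (\- (f : hom)).

Fact kdual_addA : associative kdual_add.
Proof. by move=> f g h; apply: kdual_ext => x; exact: addrA. Qed.
Fact kdual_addC : commutative kdual_add.
Proof. by move=> f g; apply: kdual_ext => x; exact: addrC. Qed.
Fact kdual_add0 : left_id kdual_zero kdual_add.
Proof. by move=> f; apply: kdual_ext => x; exact: add0r. Qed.
Fact kdual_addN : left_inverse kdual_zero kdual_opp kdual_add.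
Proof. by move=> f; apply: kdual_ext => x; exact: addNr. Qed.

HB.instance Definition _ := GRing.isZmodule.Build D
  kdual_addA kdual_addC kdual_add0 kdual_addN.

(* (f r)(x) = f (r x) *)
Definition kdual_act_fun (r : R^c) (f : D) (x : restr_scalars A X) : k^o :=
  kdual_eval f ((r : R) *: (x : X)).

Fact kdual_act_fun_linear r f : linear (kdual_act_fun r f).
Proof.
move=> a x y; rewrite /kdual_act_fun /kdual_eval.
rewrite [X in f X](_ : _ = a *: ((r : R) *: (x : X) : restr_scalars A X)
                            + ((r : R) *: (y : X) : restr_scalars A X)) ?linearP //.
transitivity ((r : R) *: (A a *: (x : X) + (y : X))) => //.
by rewrite scalerDr scalerA -structure_map_central -scalerA.
Qed.

HB.instance Definition _ r f :=
  GRing.isLinear.Build k (restr_scalars A X) k^o _ (kdual_act_fun r f)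
    (kdual_act_fun_linear r f).

Definition kdual_act (r : R^c) (f : D) : D := kdual_act_fun r f.

Fact kdual_actA r s f : kdual_act r (kdual_act s f) = kdual_act (r * s) f.
Proof. by apply: kdual_ext => x; congr (kdual_eval f _); exact: scalerA. Qed.
Fact kdual_act1 : left_id 1 kdual_act.
Proof. by move=> f; apply: kdual_ext => x; congr (kdual_eval f _); exact: scale1r. Qed.
Fact kdual_actDr : right_distributive kdual_act +%R.
Proof. by move=> r f g; exact: kdual_ext. Qed.
Fact kdual_actDl f : {morph kdual_act^~ f : r s / r + s}.
Proof.
move=> r s; apply: kdual_ext => x.
transitivity (kdual_eval f ((r : R) *: x + (s : R) *: x)); last exact: (raddfD (f : hom)).
by congr (kdual_eval f _); exact: scalerDl.
Qed.

HB.instance Definition _ := GRing.Zmodule_isLmodule.Build R^c D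
  kdual_actA kdual_act1 kdual_actDr kdual_actDl.

End Dual.

(* The k-dual of R carrying the left half of its (R,R)-bimodule structure;
   [kdual A R^o] itself carries the right half. *)
Definition hat (k : fieldType) (R : pzRingType) (A : algebra_over k R) : Type :=
  kdual A R^o.

Section Hat.
Variables (k : fieldType) (R : pzRingType) (A : algebra_over k R).

HB.instance Definition _ := GRing.Zmodule.on (hat A).

(* (r f)(s) = f (s r) *)
Definition hat_act_fun (r : R) (f : hat A) (s : restr_scalars A R^o) : k^o :=
  kdual_eval f ((s : R) * r).

Fact hat_act_fun_linear r f : linear (hat_act_fun r f).
Proof.
move=> a x y; rewrite /hat_act_fun /kdual_eval.
rewrite [X in f X](_ : _ = a *: ((x : R) * r : restr_scalars A R^o)
                            + ((y : R) * r : restr_scalars A R^o)) ?linearP //.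
transitivity ((A a * (x : R) + (y : R)) * r) => //.
by rewrite mulrDl -mulrA.
Qed.

HB.instance Definition _ r f :=
  GRing.isLinear.Build k (restr_scalars A R^o) k^o _ (hat_act_fun r f)
    (hat_act_fun_linear r f).

Definition hat_act (r : R) (f : hat A) : hat A := hat_act_fun r f.

Fact hat_actA r s f : hat_act r (hat_act s f) = hat_act (r * s) f.
Proof. by apply: kdual_ext => x; congr (kdual_eval f _); rewrite [RHS]mulrA. Qed.
Fact hat_act1 : left_id 1 hat_act.
Proof. by move=> f; apply: kdual_ext => x; congr (kdual_eval f _); exact: mulr1. Qed.
Fact hat_actDr : right_distributive hat_act +%R.
Proof. by move=> r f g; exact: kdual_ext. Qed.
Fact hat_actDl f : {morph hat_act^~ f : r s / r + s}.
Proof.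
move=> r s; apply: kdual_ext => x.
transitivity (kdual_eval f ((x : R) * r + (x : R) * s)).
  by congr (kdual_eval f _); exact: mulrDr.
exact: (raddfD (f : {linear restr_scalars A R^o -> k^o})).
Qed.

HB.instance Definition _ := GRing.Zmodule_isLmodule.Build R (hat A)
  hat_actA hat_act1 hat_actDr hat_actDl.

End Hat.

Definition frobenius (k : fieldType) (R : pzRingType) (A : algebra_over k R) : Prop :=
  finite_dim A /\ exists f : {linear R^o -> hat A}, bijective f.

Record contravariant_functor (R S : pzRingType) := ContravariantFunctor {
  fobj :> lmodType R -> lmodType S;
  fmap : forall X Y : lmodType R, {linear X -> Y} -> {linear fobj Y -> fobj X};
  fmap_id : forall X : lmodType R, fmap (idfun : {linear X -> X}) =1 idfun;
  fmap_comp : forall (X Y Z : lmodType R) (f : {linear X -> Y}) (g : {linear Y -> Z}),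
    fmap (g \o f : {linear X -> Z}) =1 fmap f \o fmap g
}.

Definition naturally_equivalent (R S : pzRingType)
    (F G : contravariant_functor R S) : Prop :=
  exists eta : forall X : lmodType R, {linear F X -> G X},
    (forall X : lmodType R, bijective (eta X)) /\
    (forall (X Y : lmodType R) (f : {linear X -> Y}),
       eta X \o fmap F f =1 fmap G f \o eta Y).

Section DualFunctor.
Variables (k : fieldType) (R : pzRingType) (A : algebra_over k R).

Section Map.
Variables (X Y : lmodType R) (u : {linear X -> Y}).

Definition kdual_pull_fun (f : kdual A Y) (x : restr_scalars A X) : k^o :=
  kdual_eval f (u (x : X)).

Fact kdual_pull_fun_linear f : linear (kdual_pull_fun f).
Proof.
move=> a x y; rewrite /kdual_pull_fun /kdual_eval.
rewrite [X in f X](_ : _ = a *: (u (x : X) : restr_scalars A Y)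
                            + (u (y : X) : restr_scalars A Y)) ?linearP //.
Qed.

HB.instance Definition _ f :=
  GRing.isLinear.Build k (restr_scalars A X) k^o _ (kdual_pull_fun f)
    (kdual_pull_fun_linear f).

(* f |-> f \o u *)
Definition kdual_map (f : kdual A Y) : kdual A X := kdual_pull_fun f.

Fact kdual_map_linear : linear kdual_map.
Proof.
move=> r f g; apply: kdual_ext => x.
by congr (kdual_eval f _ + kdual_eval g _); exact: (esym (linearZZ u (r : R) (x : X))).
Qed.

HB.instance Definition _ :=
  GRing.isLinear.Build R^c (kdual A Y) (kdual A X) _ kdual_map kdual_map_linear.

End Map.

Fact kdual_map_id (X : lmodType R) : kdual_map (idfun : {linear X -> X}) =1 idfun.
Proof. by move=> f; exact: kdual_ext. Qed.

Fact kdual_map_comp (X Y Z : lmodType R) (u : {linear X -> Y}) (v : {linear Y -> Z}) :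
  kdual_map (v \o u : {linear X -> Z}) =1 kdual_map u \o kdual_map v.
Proof. by move=> f; exact: kdual_ext. Qed.

Definition kdual_functor : contravariant_functor R R^c :=
  @ContravariantFunctor R R^c
    (fun X : lmodType R => kdual A X)
    (fun (X Y : lmodType R) (u : {linear X -> Y}) => kdual_map u)
    kdual_map_id kdual_map_comp.

End DualFunctor.

(* Main.v *)
Require Import Defs.
From HB Require Import structures.
From mathcomp Require Import all_boot all_algebra.
From mathcomp Require Import boolp classical_sets.

(* Let Z be the center of R.  Then Hom_k(X, k) is naturally
   Hom_Z(X, Hom_k(Z, k)), so it suffices to show that the Z-modules
   E_i = Hom_{k_i}(Z, k_i) are isomorphic.  A Z-map E_1 -> E_2
   amounts to a k_2-linear functional mu on E_1, and it is injective when ker mu contains no nonzero submodule.  In E_1,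
   Ann f <= Ann g implies g \in Z f, so distinct simple submodules are never
   isomorphic, and mu can be built by making it nonzero on one simple submodule
   at a time.  By symmetry E_2 embeds in E_1, and since E_1 is
   finite-dimensional over k_1 both embeddings are bijective. *)

Set Implicit Arguments.
Unset Strict Implicit.
Unset Printing Implicit Defensive.

Import GRing.Theory.
Local Open Scope ring_scope.
Local Open Scope classical_set_scope.

(** * Submodules as sets, over an arbitrary ring *)

Section Submodule.
Variables (R : pzRingType) (M : lmodType R).

(** A predicate on sets, so that one and the same [N] can be viewed over [R] and over a field
    mapping into [R]. *)
Definition submodule (N : set M) :=
  N 0 /\ forall a x y, N x -> N y -> N (a *: x + y).

Lemma submoduleD N x y : submodule N -> N x -> N y -> N (x + y).
Proof. by move=> [_ NP] Nx Ny; rewrite -[x]scale1r; exact: NP. Qed.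

Lemma submoduleZ N a x : submodule N -> N x -> N (a *: x).
Proof. by move=> [N0 NP] Nx; rewrite -[a *: x]addr0; exact: NP. Qed.

Lemma submoduleB N x y : submodule N -> N x -> N y -> N (x - y).
Proof.
by move=> sN Nx Ny; apply: submoduleD => //; rewrite -scaleN1r; exact: submoduleZ.
Qed.

Definition line (x : M) : set M := [set y | exists a, y = a *: x].

Lemma line_gen x : line x x.
Proof. by exists 1; rewrite scale1r. Qed.

Lemma submodule_line x : submodule (line x).
Proof.
split=> [|a _ _ [b ->] [c ->]]; first by exists 0; rewrite scale0r.
by exists (a * b + c); rewrite scalerDl scalerA.
Qed.

Lemma submodule_addset N P :
  submodule N -> submodule P -> submodule [set x + y | x in N & y in P].
Proof.
move=> sN sP; split=> [|a _ _ [x Nx [y Py <-]] [x' Nx' [y' Py' <-]]].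
  by exists 0; [exact: (proj1 sN) | exists 0; [exact: (proj1 sP) | rewrite addr0]].
exists (a *: x + x'); first exact: (proj2 sN).
by exists (a *: y + y'); [exact: (proj2 sP) | rewrite scalerDr addrACA].
Qed.

Definition noetherian :=
  forall F : set (set M), F !=set0 -> (forall N, F N -> submodule N) ->
  exists2 N, F N & forall N', F N' -> N `<=` N' -> N' `<=` N.

End Submodule.

(** * Linear algebra over a field: separation and finite dimension *)

Lemma separate_point (k : fieldType) (V : lmodType k) (W : set V) (v : V) :
  submodule W -> ~ W v ->
  exists2 h : {linear V -> k^o}, (forall x, W x -> h x = 0) & h v = 1.
Proof.
move=> sW Wv.
(* A subspace maximal among those containing [W] and missing [v] is a complement of the line through
   [v]; [h] will read off the coefficient of [v]. *)
pose avoids (N : set V) := [/\ submodule N, W `<=` N & ~ N v].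
(* The guard [N !=set0] accommodates the empty chain, whose union is empty. The maximal [N] is
   nonempty all the same, since [W] would be larger. *)
have [F PF totF|N [PN maxN]] := @Zorn_bigcup V (fun N => N !=set0 -> avoids N).
  move=> [x [N FN Nx]].
  have avF N' y : F N' -> N' y -> avoids N' by move=> /PF + ?; apply; exists y.
  have [sN WN Nv] := avF N x FN Nx.
  split=> [|y Wy|[N' FN' N'v]]; last by have [] := avF _ _ FN' N'v.
    split=> [|a y z [N1 FN1 N1y] [N2 FN2 N2z]].
      by exists N => //; exact: (proj1 sN).
    have [sN1 _ _] := avF _ _ FN1 N1y; have [sN2 _ _] := avF _ _ FN2 N2z.
    have [/(_ _ N1y) N2y|/(_ _ N2z) N1z] := totF _ _ FN1 FN2.
      by exists N2 => //; exact: (proj2 sN2).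
    by exists N1 => //; exact: (proj2 sN1).
  by exists N => //; exact: WN.
have [sN WN Nv] : avoids N.
  apply: PN; apply/set0P/eqP => N0; apply: (maxN W); last by split.
  by rewrite N0; split=> // /(_ 0 (proj1 sW)).
have decomp x : exists a : k, N (x - a *: v).
  have [Nx|Nx] := pselect (N x); first by exists 0; rewrite scale0r subr0.
  pose N' := [set y + z | y in N & z in line x].
  have sN' : submodule N' by exact: (submodule_addset sN (submodule_line x)).
  have NN' : N `<=` N'.
    move=> y Ny; exists y => //; exists 0; last by rewrite addr0.
    exact: (proj1 (submodule_line x)).
  have N'x : N' x.
    exists 0; first exact: (proj1 sN).
    by exists x; [exact: line_gen | rewrite add0r].
  (* By maximality the larger subspace [N'] contains [v], say [v = y + a *: x]; then [a] is nonzero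
     and can be inverted to solve for [x] modulo [N]. *)
  have [[y Ny [_ [a ->] yav]]|N'v] := pselect (N' v); last first.
    exfalso; apply: (maxN N'); first by split=> // /(_ x N'x).
    by split=> //; exact: subset_trans NN'.
  have a0 : a != 0.
    by apply/eqP => a0; apply: Nv; rewrite -yav a0 scale0r addr0.
  exists a^-1; rewrite -yav scalerDr scalerA mulVf // scale1r opprD addrCA subrr addr0.
  by rewrite -scalerN -scaleN1r scalerA; exact: submoduleZ.
have uniq_coef x a b : N (x - a *: v) -> N (x - b *: v) -> a = b.
  move=> Na Nb; apply/eqP/negP => /negP; rewrite -subr_eq0 => ab0; apply: Nv.
  have := submoduleZ (a - b)^-1 sN (submoduleB sN Nb Na).
  rewrite (_ : x - _ - _ = (a - b) *: v) ?scalerA ?mulVf ?scale1r //.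
  by rewrite opprB addrC addrA subrK scalerBl.
have [h hP] := choice decomp.
have lin_h : linear (h : V -> k^o).
  move=> a x y; apply: (uniq_coef (a *: x + y)) => //.
  rewrite scalerDl opprD addrACA -scalerA -scalerBr.
  exact: (proj2 sN).
pose L := GRing.isLinear.Build k V k^o _ (h : V -> k^o) lin_h.
exists (HB.pack (h : V -> k^o) L : {linear V -> k^o}) => [x Wx|] /=.
  by apply: (uniq_coef x) => //; rewrite scale0r subr0; exact: WN.
by apply: (uniq_coef v) => //; rewrite scale1r subrr; exact: (proj1 sN).
Qed.

(** Chosen so that [finite_dim A] is convertible to [fdim (restr_scalars A R^o)]. *)
Definition fdim (k : fieldType) (V : lmodType k) :=
  exists n : nat, inhabited (Vector.axiom n V).

(** A subspace of largest dimension inside [N] is all of [N]: adjoining the line of any [x] in [N]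
    stays inside [N], so it cannot raise the dimension. *)
Lemma submodule_vspace (k : fieldType) (V : vectType k) (N : set V) :
  submodule N -> exists U : {vspace V}, N = [set x | x \in U].
Proof.
move=> sN.
pose P n := `[< exists U : {vspace V}, \dim U = n /\ forall x, x \in U -> N x >].
have exP : exists n, P n.
  exists 0%N; apply/asboolP; exists 0%VS; rewrite dimv0; split=> // x.
  by rewrite memv0 => /eqP ->; exact: (proj1 sN).
have bndP n : P n -> (n <= \dim {:V})%N by move=> /asboolP[U [<- _]]; exact/dimvS/subvf.
have [n /asboolP[U [dU UN]] maxn] := ex_maxnP exP bndP.
exists U; apply/seteqP; split=> x /= => [Nx|]; last exact: UN.
have : P (\dim (U + <[x]>)).
  apply/asboolP; exists (U + <[x]>)%VS; split=> //.
  move=> _ /memv_addP[u /UN Nu [_ /vlineP[a ->] ->]].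
  by rewrite addrC; exact: (proj2 sN).
move=> /maxn; rewrite -dU => ge_dim.
have /eqP -> : U == (U + <[x]>)%VS by rewrite eqEdim addvSl.
by rewrite (subvP (addvSr _ _)) // memv_line.
Qed.

Lemma fdim_coord (k : fieldType) (V : lmodType k) : fdim V ->
  exists n (f : {linear V -> 'rV[k]_n}) (g : {linear 'rV[k]_n -> V}),
    cancel f g /\ cancel g f.
Proof.
move=> [n [[f lin_f [g fK gK]]]].
pose F : {linear V -> 'rV[k]_n} := HB.pack f (GRing.isLinear.Build _ _ _ _ f lin_f).
have lin_g : linear g by apply: (can2_linear (f := F)).
exists n, F, (HB.pack g (GRing.isLinear.Build _ _ _ _ g lin_g) : {linear _ -> _}).
by [].
Qed.

(** In coordinates the image of [h] is a subspace [W] of a row space, and coordinates in a basis of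
    [W] identify [U] with rows of length [\dim W]. *)
Lemma fdim_inj (k : fieldType) (V U : lmodType k) (h : {linear U -> V}) :
  fdim V -> injective h -> fdim U.
Proof.
move=> /fdim_coord[n [f [g [fK gK]]]] h_inj.
pose fh : {linear U -> 'rV[k]_n} := f \o h.
have fh_inj : injective fh by exact: inj_comp (can_inj fK) h_inj.
have [W defW] : exists W : {vspace 'rV[k]_n}, range fh = [set x | x \in W].
  apply: submodule_vspace; split=> [|a _ _ [x _ <-] [y _ <-]].
    by exists 0; rewrite ?linear0.
  by exists (a *: x + y); rewrite ?linearP.
have fhW x : fh x \in W by suff: range fh (fh x) by rewrite defW.
pose p x : 'rV[k]_(\dim W) := \row_i coord (vbasis W) i (fh x).
exists (\dim W); constructor; exists p => [a x y|].
  by apply/rowP => i; rewrite !mxE !linearP.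
have /choice[q qP] (r : 'rV[k]_(\dim W)) :
    exists x, fh x = \sum_i r 0 i *: (vbasis W)`_i.
  have : [set x | x \in W] (\sum_i r 0 i *: (vbasis W)`_i).
    by apply: memv_suml => i _; rewrite memvZ // vbasis_mem // mem_nth ?size_tuple.
  by rewrite -defW => -[x _ <-]; exists x.
exists q => [x|r].
  apply: fh_inj; rewrite qP [RHS](coord_vbasis (fhW x)).
  by apply: eq_bigr => i _; rewrite mxE.
by apply/rowP => i; rewrite mxE qP coord_sum_free // (basis_free (vbasisP W)).
Qed.

(** A member of the family of largest dimension is maximal for inclusion. *)
Lemma fdim_noetherian (k : fieldType) (V : lmodType k) : fdim V -> noetherian V.
Proof.
move=> /fdim_coord[n [f [g [fK gK]]]] F [N0 FN0] subF.
have im_vspace N : F N -> exists U : {vspace 'rV[k]_n}, forall x, x \in U <-> N (g x).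
  move=> FN; have [N0' NP] := subF N FN.
  have [|U /seteqP[NU UN]] := @submodule_vspace k _ (g @^-1` N).
    by split=> [|a x y Nx Ny] /=; rewrite ?linear0 ?linearP //; exact: NP.
  by exists U => x; split=> [/UN|/NU].
pose P m := `[< exists N (U : {vspace 'rV[k]_n}),
  [/\ F N, \dim U = m & forall x, x \in U <-> N (g x)] >].
have exP : exists m, P m.
  by have [U UP] := im_vspace _ FN0; exists (\dim U); apply/asboolP; exists N0, U.
have bndP m : P m -> (m <= \dim {:'rV[k]_n})%N.
  by move=> /asboolP[N [U [_ <- _]]]; exact/dimvS/subvf.
have [m /asboolP[N [U [FN dU UN]]] maxm] := ex_maxnP exP bndP.
exists N => // N' FN' NN'; have [U' U'N'] := im_vspace _ FN'.
have : P (\dim U') by apply/asboolP; exists N', U'.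
move=> /maxm; rewrite -dU => ge_dim x N'x.
have sUU' : (U <= U')%VS by apply/subvP => y /UN/NN'/U'N'.
have /eqP UU' : U == U' by rewrite eqEdim sUU'.
by rewrite -[x]fK; apply/UN; rewrite UU'; apply/U'N'; rewrite fK.
Qed.

Lemma fdim_inj_bij (k : fieldType) (V : lmodType k) (h : {linear V -> V}) :
  fdim V -> injective h -> bijective h.
Proof.
move=> /fdim_coord[n [f [g [fK gK]]]] h_inj.
pose e := linfun (f \o h \o g : {linear 'rV[k]_n -> 'rV[k]_n}).
have ker_e : lker e == 0%VS.
  apply/lker0P => x y; rewrite !lfunE /= => /(can_inj fK)/h_inj.
  exact: (can_inj gK).
exists (g \o (e^-1)%VF \o f) => x /=.
  by rewrite -[in f (h x)](fK x) [X in (e^-1)%VF X](_ : _ = e (f x)) ?lker0_lfunK // lfunE.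
apply: (can_inj fK); have := lker0_lfunVK ker_e (f x).
by rewrite [e _]lfunE /=.
Qed.

Lemma fdim_row (k : fieldType) n : fdim 'rV[k]_n.
Proof. by exists n; constructor; exists id => //; exists id. Qed.

(** * Restriction of scalars and evaluation of functionals *)

Section Restriction.
Variables (k : fieldType) (R : pzRingType) (A : algebra_over k R) (M : lmodType R).

Lemma restr_submodule (N : set M) :
  submodule N -> submodule (N : set (restr_scalars A M)).
Proof. by move=> [N0 NP]; split=> // a x y Nx Ny; exact: NP. Qed.

Lemma restr_noetherian : noetherian (restr_scalars A M) -> noetherian M.
Proof.
by move=> noethM F F0 subF; apply: noethM => // N FN; exact/restr_submodule/subF.
Qed.

Lemma kdual_evalD (f : kdual A M) x y :
  kdual_eval f (x + y) = kdual_eval f x + kdual_eval f y.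
Proof. exact: (raddfD (f : {linear restr_scalars A M -> k^o})). Qed.

Lemma kdual_eval0 (f : kdual A M) : kdual_eval f 0 = 0.
Proof. exact: (raddf0 (f : {linear restr_scalars A M -> k^o})). Qed.

Lemma kdual_evalZ (f : kdual A M) a x :
  kdual_eval f (A a *: x) = a * kdual_eval f x.
Proof. exact: (linearZ_LR (f : {linear restr_scalars A M -> k^o})). Qed.

Lemma kdual_addE (f g : kdual A M) x :
  kdual_eval (f + g) x = kdual_eval f x + kdual_eval g x.
Proof. by []. Qed.

Lemma kdual_separate (N : set M) x : submodule N -> ~ N x ->
  exists2 h : kdual A M, (forall y, N y -> kdual_eval h y = 0) & kdual_eval h x = 1.
Proof. by move=> sN Nx; exact: (separate_point (restr_submodule sN) Nx). Qed.

End Restriction.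

(** * The dual of a finite-dimensional algebra *)

Section HatFinite.
Variables (k : fieldType) (R : pzRingType) (A : algebra_over k R).
Hypothesis fdA : finite_dim A.

Lemma hat_actE (r : R) (f : hat A) (s : R) :
  kdual_eval (r *: f) s = kdual_eval f (s * r : R).
Proof. by []. Qed.

(** The action puts [A a] to the right of the argument; centrality moves it to the left, where [f]
    is linear. So restricting the left action along [A] gives the pointwise scaling. *)
Lemma hat_evalZ a (f : hat A) s : kdual_eval (A a *: f) s = a * kdual_eval f s.
Proof. by rewrite -[RHS]kdual_evalZ hat_actE -structure_map_central. Qed.

Lemma kdual_eval_linear (s : R) :
  linear (fun f : restr_scalars A (hat A) => kdual_eval f s : k^o).
Proof. by move=> a f g; rewrite -[RHS]/(a * _ + _) -hat_evalZ. Qed.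

Lemma dual_basis : exists n (b : 'I_n -> R) (d : 'I_n -> hat A),
  (forall s, s = \sum_i A (kdual_eval (d i) s) * b i) /\
  (forall f : hat A, f = \sum_i A (kdual_eval f (b i)) *: d i).
Proof.
have [n [c [e [cK eK]]]] := fdim_coord (fdA : fdim _).
(* The [d i] are the coordinate forms of [c], and the [b i] below are the basis vectors that they
   are dual to. *)
pose d_fun i (x : restr_scalars A R^o) : k^o := c x 0 i.
have d_lin i : linear (d_fun i) by move=> a x y; rewrite /d_fun linearP !mxE.
pose d i : hat A := HB.pack (d_fun i) (GRing.isLinear.Build _ _ _ _ _ (d_lin i)).
pose b i : R := e (delta_mx 0 i).
have bd s : s = \sum_i A (kdual_eval (d i) s) * b i.
  rewrite -[LHS](cK s) [c s]row_sum_delta linear_sum.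
  by apply: eq_bigr => i _; rewrite linearZZ.
exists n, b, d; split=> // f; apply: kdual_ext => s.
have eval_sum (x : R) F :
    kdual_eval (\sum_(i < n) F i : hat A) x = \sum_i kdual_eval (F i) x.
  by apply: (big_morph (fun f : hat A => kdual_eval f x)).
rewrite eval_sum {1}(bd s).
rewrite (big_morph (kdual_eval f) (kdual_evalD f) (kdual_eval0 f)).
by apply: eq_bigr => i _; rewrite hat_evalZ [LHS]kdual_evalZ mulrC.
Qed.

Lemma fdim_hat : fdim (restr_scalars A (hat A)).
Proof.
have [n [b [d [_ dP]]]] := dual_basis.
pose v (f : restr_scalars A (hat A)) := \row_i kdual_eval f (b i).
have v_lin : linear v.
  by move=> a f g; apply/rowP => i; rewrite !mxE [LHS]kdual_eval_linear.
pose vL : {linear restr_scalars A (hat A) -> 'rV[k]_n} :=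
  HB.pack v (GRing.isLinear.Build _ _ _ _ _ v_lin).
apply: (@fdim_inj _ _ _ vL (fdim_row k n)).
move=> f g /rowP fg; rewrite [f]dP [g]dP.
by apply: eq_bigr => i _; have := fg i; rewrite !mxE => ->.
Qed.

(** Surjectivity onto the double dual: the point [s] has the values of [h] on the dual basis as its
    coordinates. *)
Lemma hat_reflexive (h : kdual A (hat A)) :
  exists s, forall f : hat A, kdual_eval h f = kdual_eval f s.
Proof.
have [n [b [d [_ dP]]]] := dual_basis.
exists (\sum_i A (kdual_eval h (d i)) * b i) => f.
rewrite {1}(dP f).
rewrite (big_morph (kdual_eval h) (kdual_evalD h) (kdual_eval0 h)).
rewrite (big_morph (kdual_eval f) (kdual_evalD f) (kdual_eval0 f)).
by apply: eq_bigr => i _; rewrite kdual_evalZ [RHS]kdual_evalZ mulrC.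
Qed.

End HatFinite.

(** * Comparison of the two duals of a commutative ring *)

Section Cogenerator.
Variable Z : comPzRingType.

(** If [g] is outside [line f], some functional vanishes on [line f] but not at [g]. By reflexivity
    it is evaluation at some [z], and by commutativity [z] then annihilates [f] but not [g]. *)
Lemma ann_le_line (k : fieldType) (A : algebra_over k Z) (f g : hat A) :
  finite_dim A -> (forall z, z *: f = 0 -> z *: g = 0) -> line f g.
Proof.
move=> fdA fg; have [//|fNg] := pselect (line f g); exfalso.
have [h hf hg] := kdual_separate A (submodule_line f) fNg.
have [z hz] := hat_reflexive fdA h.
have zf : z *: f = 0.
  apply: kdual_ext => s; rewrite -[RHS](hf (s *: f)); last by exists s.
  by rewrite hz !hat_actE mulrC.
have := oner_neq0 k; rewrite -hg hz.
have -> : kdual_eval g z = kdual_eval (z *: g) 1.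
  by rewrite hat_actE mul1r.
by rewrite fg // eqxx.
Qed.

Section Ann.
Variable E : lmodType Z.
Hypothesis ann_line : forall f g : E, (forall z, z *: f = 0 -> z *: g = 0) -> line f g.

(** The last clause says that [line g] is simple. Take [g] with maximal annihilator among nonzero
    multiples of [f]: a nonzero [z *: g] has the same annihilator, so [ann_line] puts [g] in its
    line. *)
Lemma exists_simple (f : E) : noetherian Z^o -> f != 0 -> exists2 g, line f g &
  g != 0 /\ forall z, z *: g != 0 -> line (z *: g) g.
Proof.
move=> noethZ f0.
pose ann (g : E) : set Z^o := [set z | z *: g = 0].
have [||_ [g [fg g0 ->]] max_ann] :=
  noethZ [set I | exists g, [/\ line f g, g != 0 & I = ann g]].
- by exists (ann f), f; split=> //; exact: line_gen.
- move=> _ [g [_ _ ->]]; split=> [|a x y xg yg]; first exact: scale0r.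
  by rewrite /ann /= scalerDl -scalerA xg yg scaler0 addr0.
exists g => //; split=> // z zg; apply: ann_line => w wzg.
apply: (max_ann (ann (z *: g))) => //.
  exists (z *: g); split=> //.
  by case: fg => a ->; exists (z * a); rewrite scalerA.
by move=> x xg; rewrite /ann /= scalerA mulrC -scalerA [x *: g]xg scaler0.
Qed.

(** Take a submodule [M] maximal among those on which some [mu] is good. If the radical of [mu] is
    nonzero it contains a simple [line f] with [f] outside [M], and correcting [mu] by a functional
    that vanishes on [M] but not at [f] enlarges [M]. *)
Lemma cogenerating_functional (k : fieldType) (A : algebra_over k Z) :
    noetherian Z^o -> noetherian E ->
  exists mu : kdual A E,
    forall f, (forall z, kdual_eval mu (z *: f) = 0) -> f = 0.
Proof.
move=> noethZ noethE.
(* This is the largest submodule contained in the kernel of [mu]. *)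
pose radical (mu : kdual A E) := [set f | forall z, kdual_eval mu (z *: f) = 0].
have rad_sub mu f z : radical mu f -> radical mu (z *: f).
  by move=> muf w; rewrite scalerA.
pose good (M : set E) mu := forall f, M f -> radical mu f -> f = 0.
have [|M [] //|M [sM [mu good_mu]] maxM] :=
    noethE [set M | submodule M /\ exists mu, good M mu].
  exists [set 0]; split; last by exists 0.
  by split=> // a x y -> ->; rewrite /= scaler0 addr0.
exists mu => f0 muf0; apply/eqP/negP => /negP/(exists_simple noethZ)[f f0f [fn0 f_simple]].
have muf : radical mu f by case: f0f => z ->; exact: rad_sub.
have Mf : ~ M f by move=> Mf; case/eqP: fn0; exact: good_mu.
have [nu nuM nuf] := kdual_separate A sM Mf.
pose M' := [set x + y | x in M & y in line f].
have sM' : submodule M' by apply: submodule_addset => //; exact: submodule_line.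
case: (Mf); apply: (maxM M'); last 2 first.
- move=> x Mx; exists x => //; exists 0; last by rewrite addr0.
  exact: (proj1 (submodule_line f)).
- exists 0; first exact: (proj1 sM).
  by exists f; [exact: line_gen | rewrite add0r].
split=> //; exists (mu + nu) => _ [x Mx [_ [a ->] <-]] rad_u.
have radM y : M y -> radical (mu + nu) y -> y = 0.
  move=> My rad_y; apply: good_mu => // z.
  by rewrite -[RHS](rad_y z) kdual_addE nuM ?addr0 //; exact: submoduleZ.
have [af0|af0] := eqVneq (a *: f) 0.
  by move: rad_u; rewrite af0 addr0; exact: radM.
(* Simplicity allows rescaling the coefficient of [f] to 1, leaving [y + f] in the radical with [y]
   in [M]. *)
have [b fE] := f_simple _ af0.
have {rad_u} rad_u : radical (mu + nu) (b *: x + f).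
  by rewrite fE -scalerDr; exact: rad_sub.
have My : M (b *: x) by exact: submoduleZ.
exfalso; move: (b *: x) My rad_u => y My rad_u.
(* If [z] kills [f], then [z *: y = z *: (y + f)] lies in [M] and in the radical. Hence [y] is a
   multiple of [f], and a nonzero one would bring [f] into [M]. *)
have ann_fy z : z *: f = 0 -> z *: y = 0.
  move=> zf; apply: radM; first exact: submoduleZ.
  by have := rad_sub _ _ z rad_u; rewrite scalerDr zf addr0.
have y0 : y = 0.
  have [c yE] := ann_line ann_fy; apply/eqP/negP => /negP.
  by rewrite yE => /f_simple[d fE']; apply: Mf; rewrite fE' -yE; exact: submoduleZ.
(* Now [f] itself is in the radical of [mu + nu], yet [mu] is 0 and [nu] is 1 at [f]. *)
have := rad_u 1; rewrite y0 add0r scale1r kdual_addE nuf.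
by rewrite -[f]scale1r muf add0r => /eqP; rewrite oner_eq0.
Qed.

End Ann.

(** A cogenerating [k2]-functional [mu] on [hat A1] yields the map sending [f] to
    [z |-> mu (z *: f)]; its kernel is the radical of [mu], which is zero. *)
Lemma hat_embedding (k1 k2 : fieldType)
    (A1 : algebra_over k1 Z) (A2 : algebra_over k2 Z) :
  finite_dim A1 -> exists phi : {linear hat A1 -> hat A2}, injective phi.
Proof.
move=> fd1.
have noethZ : noetherian Z^o by exact/(@restr_noetherian _ _ A1)/fdim_noetherian.
have noethE : noetherian (hat A1).
  exact/(@restr_noetherian _ _ A1)/fdim_noetherian/fdim_hat.
have [mu mu_inj] :=
  cogenerating_functional (fun f g => ann_le_line fd1) A2 noethZ noethE.
pose ev f (z : restr_scalars A2 Z^o) : k2^o := kdual_eval mu ((z : Z) *: f).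
have ev_lin f : linear (ev f).
  move=> a x y; rewrite -[RHS]/(a * _ + _) -kdual_evalZ -kdual_evalD.
  by rewrite scalerA -scalerDl.
pose phi f : hat A2 := HB.pack (ev f) (GRing.isLinear.Build _ _ _ _ _ (ev_lin f)).
have phi_lin : linear phi.
  move=> a f g; apply: kdual_ext => z.
  by rewrite -[LHS]/(kdual_eval mu _) scalerDr kdual_evalD scalerA.
pose phiL : {linear hat A1 -> hat A2} :=
  HB.pack phi (GRing.isLinear.Build _ _ _ _ _ phi_lin).
exists phiL.
apply: raddf_inj => f phif0; apply: mu_inj => z.
by rewrite -[LHS]/(kdual_eval (phi f) z) [phi f]phif0.
Qed.

Lemma hat_isomorphism (k1 k2 : fieldType)
    (A1 : algebra_over k1 Z) (A2 : algebra_over k2 Z) :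
  finite_dim A1 -> finite_dim A2 ->
  exists phi : {linear hat A1 -> hat A2}, bijective phi.
Proof.
move=> fd1 fd2.
have [phi phi_inj] := hat_embedding A2 fd1.
have [psi psi_inj] := hat_embedding A1 fd2.
pose c (f : restr_scalars A1 (hat A1)) : restr_scalars A1 (hat A1) := psi (phi f).
have c_lin : linear c.
  by move=> a f g; rewrite /c -[LHS]/(psi (phi (A1 a *: f + g))) !linearP.
pose cL : {linear restr_scalars A1 (hat A1) -> restr_scalars A1 (hat A1)} :=
  HB.pack c (GRing.isLinear.Build _ _ _ _ _ c_lin).
have [|d cK dK] := @fdim_inj_bij _ _ cL (fdim_hat fd1).
  by move=> f g /psi_inj/phi_inj.
(* With [d] inverse to [psi \o phi], the map [d \o psi] is a left inverse of [phi], and a right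
   inverse by injectivity of [psi]. *)
by exists phi; exists (d \o psi) => f /=; [exact: cK | apply: psi_inj; exact: dK].
Qed.

End Cogenerator.

(** * The center, its algebra structures, and currying over it *)

Section Center.
Variable R : pzRingType.

Definition central : {pred R} := fun r => `[< forall s, r * s = s * r >].

Lemma centralP r : reflect (forall s, r * s = s * r) (r \in central).
Proof. exact: asboolP. Qed.

Fact central_subring : subring_closed central.
Proof.
split=> [|x y /centralP xC /centralP yC|x y /centralP xC /centralP yC];
  apply/centralP => s.
- by rewrite mul1r mulr1.
- by rewrite mulrBl mulrBr xC yC.
- by rewrite -mulrA yC mulrA xC mulrA.
Qed.

HB.instance Definition _ := GRing.isSubringClosed.Build R central central_subring.

Record center := Center { center_val :> R; centerP : center_val \in central }.

HB.instance Definition _ := [isSub for center_val].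
HB.instance Definition _ := [Choice of center by <:].
HB.instance Definition _ :=
  GRing.SubChoice_isSubPzRing.Build R central center central_subring.

Fact center_mulC : commutative (@GRing.mul center).
Proof. by move=> x y; apply: val_inj; rewrite !rmorphM; exact/centralP/centerP. Qed.

HB.instance Definition _ := GRing.PzRing_hasCommutativeMul.Build center center_mulC.

Section CenterAlgebra.
Variables (k : fieldType) (A : algebra_over k R).

Fact structure_map_in_center a : A a \in central.
Proof. by apply/centralP => s; exact: structure_map_central. Qed.

Definition center_map a : center := Center (structure_map_in_center a).

Fact center_map_zmod : zmod_morphism center_map.
Proof. by move=> a b; apply: val_inj; rewrite rmorphB; exact: rmorphB. Qed.

Fact center_map_monoid : monoid_morphism center_map.
Proof.
split=> [|a b]; apply: val_inj; first by rewrite rmorph1; exact: rmorph1.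
by rewrite rmorphM; exact: rmorphM.
Qed.

HB.instance Definition _ :=
  GRing.isZmodMorphism.Build k center center_map center_map_zmod.
HB.instance Definition _ :=
  GRing.isMonoidMorphism.Build k center center_map center_map_monoid.

Definition center_algebra : algebra_over k center :=
  @AlgebraOver k center center_map (fun a z => mulrC (center_map a) z).

Lemma center_finite_dim : finite_dim A -> finite_dim center_algebra.
Proof.
pose v (z : restr_scalars center_algebra center^o) : restr_scalars A R^o :=
  val (z : center).
have v_lin : linear v by [].
pose vL : {linear restr_scalars center_algebra center^o -> restr_scalars A R^o} :=
  HB.pack v (GRing.isLinear.Build _ _ _ _ _ v_lin).
by move=> fdA; apply: (@fdim_inj _ _ _ vL fdA); exact: val_inj.
Qed.

Section Curry.
Variable X : lmodType R.

(** One half of the adjunction between [Hom_k(X, k)] and [Hom_Z(X, Hom_k(Z, k))]; evaluation at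
    [z = 1] recovers [f]. *)
Definition curry_fun (f : kdual A X) (x : X)
    (z : restr_scalars center_algebra center^o) : k^o :=
  kdual_eval f (val (z : center) *: x).

Fact curry_fun_linear f x : linear (curry_fun f x).
Proof.
move=> a y z; rewrite /curry_fun -[RHS]/(a * _ + _) -kdual_evalZ -kdual_evalD.
by rewrite scalerA -scalerDl.
Qed.

HB.instance Definition _ f x :=
  GRing.isLinear.Build k (restr_scalars center_algebra center^o) k^o _
    (curry_fun f x) (curry_fun_linear f x).

Definition curry f x : hat center_algebra := curry_fun f x.

Lemma curryE f x z : kdual_eval (curry f x) z = kdual_eval f (val z *: x).
Proof. by []. Qed.

Lemma curryD f x y : curry f (x + y) = curry f x + curry f y.
Proof. by apply: kdual_ext => z; rewrite kdual_addE !curryE scalerDr kdual_evalD. Qed.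

Lemma curryDl f g x : curry (f + g) x = curry f x + curry g x.
Proof. exact: kdual_ext. Qed.

Lemma curryZ f (z : center) x : curry f (val z *: x) = z *: curry f x.
Proof. by apply: kdual_ext => w; rewrite curryE scalerA. Qed.

Lemma curry_act f (r : R) x : curry ((r : R^c) *: f) x = curry f (r *: x).
Proof.
apply: kdual_ext => z; rewrite [RHS]curryE scalerA (centralP _ (centerP z)) -scalerA.
by [].
Qed.

End Curry.
End CenterAlgebra.

(** * Transport of functionals from [k1] to [k2] *)

Section Transport.
Variables (k1 k2 : fieldType) (A1 : algebra_over k1 R) (A2 : algebra_over k2 R).
Variable phi : {linear hat (center_algebra A1) -> hat (center_algebra A2)}.
Variable X : lmodType R.

(** Curry over the center, apply [phi], and uncurry by evaluating at 1. *)
Definition transport_fun (f : kdual A1 X) (x : restr_scalars A2 X) : k2^o :=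
  kdual_eval (phi (curry f x)) 1.

(** A scalar of [k2] acts on [X] through a central element, and both [curry f] and [phi] commute
    with the center; on the target this action is [k2]-scaling. *)
Fact transport_fun_linear f : linear (transport_fun f).
Proof.
move=> a x y; rewrite /transport_fun -[_ *: x]/(val (center_map A2 a) *: (x : X)).
rewrite curryD curryZ linearD kdual_addE linearZ_LR.
congr (_ + _); exact: (hat_evalZ (A := center_algebra A2)).
Qed.

HB.instance Definition _ f := GRing.isLinear.Build k2 (restr_scalars A2 X) k2^o _
  (transport_fun f) (transport_fun_linear f).

Definition transport f : kdual A2 X := transport_fun f.

Fact transport_linear : linear transport.
Proof.
move=> r f g; apply: kdual_ext => x.
rewrite -[LHS]/(kdual_eval (phi (curry (r *: f + g) x)) 1) curryDl linearD.
by rewrite curry_act.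
Qed.

HB.instance Definition _ :=
  GRing.isLinear.Build R^c (kdual A1 X) (kdual A2 X) _ transport transport_linear.

(** After currying, transport is composition with [phi], so an inverse of [phi] induces an inverse
    of transport. *)
Lemma curry_transport f x : curry (transport f) x = phi (curry f x).
Proof.
apply: kdual_ext => z; rewrite curryE.
rewrite -[LHS]/(kdual_eval (phi (curry f (val z *: x))) 1) curryZ linearZ_LR.
by rewrite hat_actE mul1r.
Qed.

End Transport.

Lemma transportK (k1 k2 : fieldType) (A1 : algebra_over k1 R) (A2 : algebra_over k2 R)
    (phi : {linear hat (center_algebra A1) -> hat (center_algebra A2)})
    (psi : {linear hat (center_algebra A2) -> hat (center_algebra A1)}) X :
  cancel phi psi -> cancel (@transport _ _ A1 A2 phi X) (transport psi (X := X)).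
Proof.
move=> phiK f; apply: kdual_ext => x.
rewrite -[LHS]/(kdual_eval (psi (curry (transport phi f) x)) 1) curry_transport phiK.
by rewrite curryE scale1r.
Qed.

End Center.

Theorem corollary2 (R : pzRingType) (k1 k2 : fieldType)
    (A1 : algebra_over k1 R) (A2 : algebra_over k2 R)
    (fd1 : finite_dim A1) (fd2 : finite_dim A2) (frob1 : frobenius A1) :
  naturally_equivalent (kdual_functor A1) (kdual_functor A2).
Proof.
have [phi [psi phiK psiK]] :=
  hat_isomorphism (center_finite_dim fd1) (center_finite_dim fd2).
pose psiL : {linear hat (center_algebra A2) -> hat (center_algebra A1)} :=
  HB.pack psi (GRing.isLinear.Build _ _ _ _ psi (can2_linear phiK psiK)).
exists (fun X : lmodType R => transport phi (X := X)); split=> [X|X Y u f].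
  by exists (transport psiL (X := X)); exact: transportK.
apply: kdual_ext => x /=.
rewrite -[LHS]/(kdual_eval (phi (curry (kdual_map u f) x)) 1).
rewrite -[RHS]/(kdual_eval (phi (curry f (u x))) 1).
(* Naturality holds before [phi] is applied: [u] commutes with the action of the central element
   [z]. *)
congr (kdual_eval (phi _) _); apply: kdual_ext => z.
by rewrite curryE [RHS]curryE -linearZZ.
Qed.
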